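(* Let $r$ be a square root on a pseudo MV-algebra $(M;\oplus,^-,^\sim,0,1)$. If $M$ is strongly atomless, then $r$ is strict.
   Context: A pseudo MV-algebra is an algebra $(M;\oplus,^-,^\sim,0,1)$ of type $(2,1,1,0,0)$ such that, writing $x\odot y:=(y^-\oplus x^-)^\sim$, for all $x,y,z\in M$: (A1) $x\oplus(y\oplus z)=(x\oplus y)\oplus z$; (A2) $x\oplus 0=0\oplus x=x$; (A3) $x\oplus 1=1\oplus x=1$; (A4) $1^-=1^\sim=0$; (A5) $(x^-\oplus y^-)^\sim=(x^\sim\oplus y^\sim)^-$; (A6) $x\oplus(x^\sim\odot y)=y\oplus(y^\sim\odot x)=(x\odot y^-)\oplus y=(y\odot x^-)\oplus x$; (A7) $x\odot(x^-\oplus y)=(x\oplus y^\sim)\odot y$; (A8) $(x^-)^\sim=x$. It is a bounded distributive lattice whose join $x\vee y$ is the common value in (A6) and whose meet $x\wedge y$ is the common value in (A7); $\le$ is the lattice order. Put $x\to y:=x^-\oplus y$ and $x\rightsquigarrow y:=y\oplus x^\sim$. A map $r:M\to M$ is a square root on $M$ if (Sq1) $r(x)\odot r(x)=x$ for all $x\in M$; (Sq2) for all $x,y\in M$, $y\odot y\le x$ implies $y\le r(x)$; (Sq3) for all $x\in M$, $r(x^-)=r(x)\to r(0)$ and $r(x^\sim)=r(x)\rightsquigarrow r(0)$. A square root $r$ is strict if $r(0)=r(0)^-$. An ideal of $M$ is a non-empty downward closed subset closed under $\oplus$. An ideal $I$ is prime if $x\wedge y\in I$ implies $x\in I$ or $y\in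 I$, and normal if $x\oplus I=I\oplus x$ for all $x\in M$. For a normal ideal $I$, $M/I$ is the quotient pseudo MV-algebra by the congruence $x\sim_I y\iff x\odot y^-,\,y\odot x^-\in I$, and $x/I$ is the class of $x$. An atom is a minimal non-zero element. $M$ is strongly atomless if for each $x\in M\setminus\{0\}$ there is a normal prime ideal $P$ such that $x\notin P$ and $x/P$ is not an atom of $M/P$. *)

(* Defs.v *)
From HB Require Import structures.
From mathcomp Require Import all_boot.
From mathcomp Require Import generic_quotient.
From mathcomp Require Import boolp classical_sets.

Set Implicit Arguments.
Unset Strict Implicit.
Unset Printing Implicit Defensive.

Declare Scope pmv_scope.
Delimit Scope pmv_scope with pmv.
Local Open Scope classical_set_scope.
Local Open Scope quotient_scope.
Local Open Scope pmv_scope.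

Reserved Notation "x \oplus y" (at level 50, left associativity).
Reserved Notation "x \odot y" (at level 40, left associativity).
Reserved Notation "x \meet y" (at level 48, left associativity).
Reserved Notation "x \join y" (at level 52, left associativity).
Reserved Notation "x ^[-]" (at level 1, left associativity, format "x ^[-]").
Reserved Notation "x ^[~]" (at level 1, left associativity, format "x ^[~]").

(* The signature is separated from the axioms so that the derived operation
   \odot is available when stating the axioms.  [mneg x], [tneg x] are the two
   negations x^- and x^~ of a pseudo MV-algebra. *)
HB.mixin Record hasPMVOps M of Choice M := {
  oplus : M -> M -> M;
  mneg : M -> M;
  tneg : M -> M;
  pmv0 : M;
  pmv1 : M
}.

#[short(type="pmvOpsType")]
HB.structure Definition PMVOps := {M of Choice M & hasPMVOps M}.

Notation "x \oplus y" := (oplus x y) : pmv_scope.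
Notation "x ^[-]" := (mneg x) : pmv_scope.
Notation "x ^[~]" := (tneg x) : pmv_scope.
Notation "0" := pmv0 : pmv_scope.
Notation "1" := pmv1 : pmv_scope.

Section Operations.
Context {M : pmvOpsType}.
Implicit Types x y : M.

Definition odot x y : M := (y^[-] \oplus x^[-])^[~].
Definition pmv_join x y : M := x \oplus odot x^[~] y.
Definition pmv_meet x y : M := odot x (x^[-] \oplus y).
Definition pmv_le x y : Prop := pmv_meet x y = x.
(* x -> y and x ~> y; these differ in a noncommutative algebra. *)
Definition limpl x y : M := x^[-] \oplus y.
Definition rimpl x y : M := y \oplus x^[~].

Definition atom x : Prop :=
  x <> 0 /\ forall y, pmv_le y x -> y <> 0 -> y = x.

End Operations.

Notation "x \odot y" := (odot x y) : pmv_scope.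
Notation "x \join y" := (pmv_join x y) : pmv_scope.
Notation "x \meet y" := (pmv_meet x y) : pmv_scope.

HB.mixin Record isPseudoMV M of PMVOps M := {
  oplusA : forall x y z : M, x \oplus (y \oplus z) = (x \oplus y) \oplus z;
  oplusx0 : forall x : M, x \oplus 0 = x;
  oplus0x : forall x : M, 0 \oplus x = x;
  oplusx1 : forall x : M, x \oplus 1 = 1;
  oplus1x : forall x : M, 1 \oplus x = 1;
  mneg1 : (1 : M)^[-] = 0;
  tneg1 : (1 : M)^[~] = 0;
  mneg_tneg_oplus : forall x y : M,
    (x^[-] \oplus y^[-])^[~] = (x^[~] \oplus y^[~])^[-];
  joinC : forall x y : M, x \oplus (x^[~] \odot y) = y \oplus (y^[~] \odot x);
  joinE : forall x y : M,
    y \oplus (y^[~] \odot x) = (x \odot y^[-]) \oplus y;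
  joinE' : forall x y : M,
    (x \odot y^[-]) \oplus y = (y \odot x^[-]) \oplus x;
  meetE : forall x y : M, x \odot (x^[-] \oplus y) = (x \oplus y^[~]) \odot y;
  mnegK : forall x : M, (x^[-])^[~] = x
}.

#[short(type="pseudoMVType")]
HB.structure Definition PseudoMV := {M of PMVOps M & isPseudoMV M}.

Section SquareRoot.
Context {M : pseudoMVType}.

Definition square_root (r : M -> M) : Prop :=
  [/\ forall x, r x \odot r x = x,
      forall x y, pmv_le (y \odot y) x -> pmv_le y (r x)
    & forall x, r x^[-] = limpl (r x) (r 0) /\
                r x^[~] = rimpl (r x) (r 0)].

Definition strict_square_root (r : M -> M) : Prop := r 0 = (r 0)^[-].

End SquareRoot.

Section Ideals.
Context {M : pseudoMVType}.
Implicit Types I : set M.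

Definition ideal I : Prop :=
  [/\ I !=set0,
      forall x y, pmv_le x y -> I y -> I x
    & forall x y, I x -> I y -> I (x \oplus y)].

(* Properness is not required: the improper ideal counts as prime. *)
Definition prime_ideal I : Prop :=
  ideal I /\ forall x y, I (x \meet y) -> I x \/ I y.

Definition normal_ideal I : Prop :=
  ideal I /\
  forall x, [set x \oplus i | i in I] = [set i \oplus x | i in I].

Definition ideal_cong I (x y : M) : Prop :=
  I (x \odot y^[-]) /\ I (y \odot x^[-]).

End Ideals.

Section Arithmetic.
Context {M : pseudoMVType}.
Implicit Types x y z : M.

Lemma tneg0 : (0 : M)^[~] = 1.
Proof. by rewrite -mneg1 mnegK. Qed.

Lemma mneg0 : (0 : M)^[-] = 1.
Proof.
by have := mneg_tneg_oplus (1 : M) 1; rewrite mneg1 tneg1 oplusx0 tneg0.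
Qed.

Lemma tnegK x : (x^[~])^[-] = x.
Proof.
by have := mneg_tneg_oplus x 1; rewrite mneg1 tneg1 !oplusx0 mnegK.
Qed.

Lemma odotE x y : x \odot y = (y^[~] \oplus x^[~])^[-].
Proof. by rewrite -mneg_tneg_oplus. Qed.

Lemma mneg_oplus x y : (x \oplus y)^[-] = y^[-] \odot x^[-].
Proof. by rewrite odotE !mnegK. Qed.

Lemma tneg_oplus x y : (x \oplus y)^[~] = y^[~] \odot x^[~].
Proof. by rewrite /odot !tnegK. Qed.

Lemma mneg_odot x y : (x \odot y)^[-] = y^[-] \oplus x^[-].
Proof. by rewrite /odot tnegK. Qed.

Lemma tneg_odot x y : (x \odot y)^[~] = y^[~] \oplus x^[~].
Proof. by rewrite odotE mnegK. Qed.

Lemma odotA x y z : x \odot (y \odot z) = (x \odot y) \odot z.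
Proof. by rewrite /odot !tnegK oplusA. Qed.

Lemma odotx1 x : x \odot 1 = x.
Proof. by rewrite /odot mneg1 oplus0x mnegK. Qed.

Lemma odot1x x : 1 \odot x = x.
Proof. by rewrite /odot mneg1 oplusx0 mnegK. Qed.

Lemma odotx0 x : x \odot 0 = 0.
Proof. by rewrite /odot mneg0 oplus1x tneg1. Qed.

Lemma odot0x x : 0 \odot x = 0.
Proof. by rewrite /odot mneg0 oplusx1 tneg1. Qed.

Lemma oplus_tneg x : x \oplus x^[~] = 1.
Proof. by have := joinC x 1; rewrite odotx1 oplus1x. Qed.

Lemma mneg_oplusx x : x^[-] \oplus x = 1.
Proof. by rewrite -{2}(mnegK x) oplus_tneg. Qed.

Lemma odot_mneg x : x \odot x^[-] = 0.
Proof. by rewrite -(tnegK (x \odot _)) tneg_odot mnegK oplus_tneg mneg1. Qed.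

Lemma tneg_odotx x : x^[~] \odot x = 0.
Proof. by rewrite -{2}(tnegK x) odot_mneg. Qed.

Lemma le_oplusr x y : y^[~] \odot x = 0 -> pmv_le x y.
Proof.
move=> h; have := mneg_odot y^[~] x; rewrite h tnegK mneg0 => e.
by rewrite /pmv_le /pmv_meet -e odotx1.
Qed.

Lemma leE x y : pmv_le x y <-> x \odot y^[-] = 0.
Proof.
split=> [|h]; first by rewrite /pmv_le /pmv_meet meetE => <-;
  rewrite -odotA odot_mneg odotx0.
apply: le_oplusr.
have := joinE x y; rewrite h oplus0x -joinC => <-.
by rewrite tneg_oplus -odotA tneg_odotx odotx0.
Qed.

Lemma leE' x y : pmv_le x y <-> y^[~] \odot x = 0.
Proof.
split=> [/leE h|]; last exact: le_oplusr.
have := joinE x y; rewrite h oplus0x -joinC => <-.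
by rewrite tneg_oplus -odotA tneg_odotx odotx0.
Qed.

Lemma le_refl x : pmv_le x x.
Proof. by apply/leE; rewrite odot_mneg. Qed.

Lemma le_addr x y : pmv_le x (x \oplus y).
Proof. by apply/leE'; rewrite tneg_oplus -odotA tneg_odotx odotx0. Qed.

Lemma le_addl x y : pmv_le x (y \oplus x).
Proof. by apply/leE; rewrite mneg_oplus odotA odot_mneg odot0x. Qed.

Lemma le_exr x y : pmv_le x y -> y = x \oplus (x^[~] \odot y).
Proof. by move=> /leE h; rewrite joinC joinE h oplus0x. Qed.

Lemma le_exl x y : pmv_le x y -> y = (y \odot x^[-]) \oplus x.
Proof. by move=> /leE h; rewrite joinE' h oplus0x. Qed.

Lemma le_trans x y z : pmv_le x y -> pmv_le y z -> pmv_le x z.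
Proof. by move=> /le_exr -> /le_exr ->; rewrite -oplusA; exact: le_addr. Qed.

Lemma le_anti x y : pmv_le x y -> pmv_le y x -> x = y.
Proof. by move=> /le_exr h /leE' k; rewrite h k oplusx0. Qed.

Lemma le_oplus2l z x y : pmv_le x y -> pmv_le (z \oplus x) (z \oplus y).
Proof. by move=> /le_exr ->; rewrite oplusA; exact: le_addr. Qed.

Lemma le_oplus2r z x y : pmv_le x y -> pmv_le (x \oplus z) (y \oplus z).
Proof. by move=> /le_exl ->; rewrite -oplusA; exact: le_addl. Qed.

Lemma le_residr x y z : pmv_le (x \odot y) z <-> pmv_le x (z \oplus y^[~]).
Proof. by rewrite !leE mneg_oplus tnegK odotA. Qed.

Lemma le_residl x y z : pmv_le (x \odot y) z <-> pmv_le y (x^[-] \oplus z).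
Proof. by rewrite !leE' tneg_oplus mnegK odotA. Qed.

Lemma le_mneg x y : pmv_le x y -> pmv_le y^[-] x^[-].
Proof. by rewrite leE leE' mnegK. Qed.

Lemma le_tneg x y : pmv_le x y -> pmv_le y^[~] x^[~].
Proof. by rewrite leE' leE tnegK. Qed.

End Arithmetic.

Section Congruence.
Context {M : pseudoMVType} (I : set M) (nI : normal_ideal I).
Implicit Types x y z : M.

Lemma cong_leP x y :
  I (x \odot y^[-]) <-> exists2 i, I i & pmv_le x (i \oplus y).
Proof.
case: nI => [[_ Ile _] _]; split=> [h|[i Ii]].
  exists (x \odot y^[-]) => //.
  by have := le_refl (x \odot y^[-]); rewrite le_residr mnegK.
rewrite -{1}(mnegK y) -le_residr => h; exact: Ile h Ii.
Qed.

Lemma normal_lr x i : I i -> exists2 j, I j & i \oplus x = x \oplus j.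
Proof.
move=> Ii; have [_ /(_ x) e] := nI.
have : [set j \oplus x | j in I] (i \oplus x) by exists i.
by rewrite -e => -[j Ij <-]; exists j.
Qed.

Lemma normal_rl x i : I i -> exists2 j, I j & x \oplus i = j \oplus x.
Proof.
move=> Ii; have [_ /(_ x) e] := nI.
have : [set x \oplus j | j in I] (x \oplus i) by exists i.
by rewrite e => -[j Ij <-]; exists j.
Qed.

Lemma cong_lePr x y :
  I (x \odot y^[-]) <-> exists2 i, I i & pmv_le x (y \oplus i).
Proof.
rewrite cong_leP; split=> -[i Ii h].
  by have [j Ij e] := normal_lr y Ii; exists j; rewrite -?e.
by have [j Ij e] := normal_rl y Ii; exists j; rewrite -?e.
Qed.

Lemma cong_le_trans x y z :
  I (x \odot y^[-]) -> I (y \odot z^[-]) -> I (x \odot z^[-]).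
Proof.
rewrite !cong_leP => -[i Ii h] [j Ij k]; exists (i \oplus j).
  by case: nI => [[_ _ +] _]; apply.
by apply: le_trans h _; rewrite -oplusA; exact: le_oplus2l.
Qed.

Lemma cong_le_oplus x y x' y' : I (x \odot x'^[-]) -> I (y \odot y'^[-]) ->
  I ((x \oplus y) \odot (x' \oplus y')^[-]).
Proof.
move=> /cong_leP[i Ii h] /cong_lePr[j Ij k].
apply: (@cong_le_trans _ (x' \oplus y)).
  by apply/cong_leP; exists i => //; rewrite oplusA; exact: le_oplus2r.
by apply/cong_lePr; exists j => //; rewrite -oplusA; exact: le_oplus2l.
Qed.

Lemma cong_le_mneg x y : I (x \odot y^[-]) -> I (y^[-] \odot x^[-]^[-]).
Proof.
move=> /cong_leP[i Ii h]; apply/cong_lePr; exists i => //.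
rewrite -(tnegK i) -mneg_odot; apply: le_mneg.
by apply/le_residl; rewrite tnegK.
Qed.

Lemma cong_le_tneg x y : I (x \odot y^[-]) -> I (y^[~] \odot x^[~]^[-]).
Proof.
move=> /cong_lePr[i Ii h]; apply/cong_leP; exists i => //.
rewrite -(mnegK i) -tneg_odot; apply: le_tneg.
by apply/le_residr; rewrite mnegK.
Qed.

Lemma ideal_cong_refl x : ideal_cong I x x.
Proof.
have [[[i Ii] Ile _] _] := nI.
suff : I (x \odot x^[-]) by [].
by apply/cong_leP; exists i => //; exact: le_addl.
Qed.

Definition ideal_rel : rel M := fun x y => `[< ideal_cong I x y >].

Lemma ideal_rel_refl : reflexive ideal_rel.
Proof. by move=> x; apply/asboolP; exact: ideal_cong_refl. Qed.

Lemma ideal_rel_sym : symmetric ideal_rel.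
Proof. by move=> x y; apply/asboolP/asboolP => -[]. Qed.

Lemma ideal_rel_trans : transitive ideal_rel.
Proof.
move=> y x z /asboolP[xy yx] /asboolP[yz zy].
by apply/asboolP; split; [exact: cong_le_trans yz | exact: cong_le_trans yx].
Qed.

Definition ideal_equiv :=
  EquivRel ideal_rel ideal_rel_refl ideal_rel_sym ideal_rel_trans.

Definition quotient := {eq_quot ideal_equiv}.

HB.instance Definition _ := Choice.on quotient.
HB.instance Definition _ := EqQuotient.on quotient.

Definition quot_class (x : M) : quotient := \pi_quotient x.

Lemma quot_classP x y : quot_class x = quot_class y <-> ideal_cong I x y.
Proof.
split=> [/eqmodP/asboolP //|h].
by apply/eqmodP/asboolP.
Qed.

(* The operations of the quotient, computed on representatives. *)
Definition quot_oplus (a b : quotient) := quot_class (repr a \oplus repr b).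
Definition quot_mneg (a : quotient) := quot_class (repr a)^[-].
Definition quot_tneg (a : quotient) := quot_class (repr a)^[~].

HB.instance Definition _ := hasPMVOps.Build quotient
  quot_oplus quot_mneg quot_tneg (quot_class 0) (quot_class 1).

Lemma quot_classK (a : quotient) : quot_class (repr a) = a.
Proof. exact: reprK. Qed.

Lemma repr_class x : ideal_cong I (repr (quot_class x)) x.
Proof. by apply/quot_classP; rewrite quot_classK. Qed.

Lemma quot_class_oplus x y :
  quot_class x \oplus quot_class y = quot_class (x \oplus y).
Proof.
apply/quot_classP; have [? ?] := repr_class x; have [? ?] := repr_class y.
by split; exact: cong_le_oplus.
Qed.

Lemma quot_class_mneg x : (quot_class x)^[-] = quot_class x^[-].
Proof.
by apply/quot_classP; have [? ?] := repr_class x; split; exact: cong_le_mneg.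
Qed.

Lemma quot_class_tneg x : (quot_class x)^[~] = quot_class x^[~].
Proof.
by apply/quot_classP; have [? ?] := repr_class x; split; exact: cong_le_tneg.
Qed.

Lemma quot_class_odot x y :
  quot_class x \odot quot_class y = quot_class (x \odot y).
Proof.
by rewrite /odot !quot_class_mneg quot_class_oplus quot_class_tneg.
Qed.

Let quotE := (quot_class_oplus, quot_class_mneg, quot_class_tneg,
              quot_class_odot).

Lemma quot_ind (P : quotient -> Prop) :
  (forall x, P (quot_class x)) -> forall a, P a.
Proof. by move=> h a; rewrite -(quot_classK a). Qed.

Fact quot_oplusA (a b c : quotient) :
  a \oplus (b \oplus c) = (a \oplus b) \oplus c.
Proof.
elim/quot_ind: a => x; elim/quot_ind: b => y; elim/quot_ind: c => z.
by rewrite !quotE oplusA.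
Qed.
Fact quot_oplusx0 (a : quotient) : a \oplus 0 = a.
Proof. by elim/quot_ind: a => x; rewrite quotE oplusx0. Qed.
Fact quot_oplus0x (a : quotient) : 0 \oplus a = a.
Proof. by elim/quot_ind: a => x; rewrite quotE oplus0x. Qed.
Fact quot_oplusx1 (a : quotient) : a \oplus 1 = 1.
Proof. by elim/quot_ind: a => x; rewrite quotE oplusx1. Qed.
Fact quot_oplus1x (a : quotient) : 1 \oplus a = 1.
Proof. by elim/quot_ind: a => x; rewrite quotE oplus1x. Qed.
Fact quot_mneg1 : (1 : quotient)^[-] = 0.
Proof. by rewrite quotE mneg1. Qed.
Fact quot_tneg1 : (1 : quotient)^[~] = 0.
Proof. by rewrite quotE tneg1. Qed.
Fact quot_mneg_tneg_oplus (a b : quotient) :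
  (a^[-] \oplus b^[-])^[~] = (a^[~] \oplus b^[~])^[-].
Proof.
elim/quot_ind: a => x; elim/quot_ind: b => y.
by rewrite !quotE mneg_tneg_oplus.
Qed.
Fact quot_joinC (a b : quotient) :
  a \oplus (a^[~] \odot b) = b \oplus (b^[~] \odot a).
Proof.
by elim/quot_ind: a => x; elim/quot_ind: b => y; rewrite !quotE joinC.
Qed.
Fact quot_joinE (a b : quotient) :
  b \oplus (b^[~] \odot a) = (a \odot b^[-]) \oplus b.
Proof.
by elim/quot_ind: a => x; elim/quot_ind: b => y; rewrite !quotE joinE.
Qed.
Fact quot_joinE' (a b : quotient) :
  (a \odot b^[-]) \oplus b = (b \odot a^[-]) \oplus a.
Proof.
by elim/quot_ind: a => x; elim/quot_ind: b => y; rewrite !quotE joinE'.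
Qed.
Fact quot_meetE (a b : quotient) :
  a \odot (a^[-] \oplus b) = (a \oplus b^[~]) \odot b.
Proof.
by elim/quot_ind: a => x; elim/quot_ind: b => y; rewrite !quotE meetE.
Qed.
Fact quot_mnegK (a : quotient) : (a^[-])^[~] = a.
Proof. by elim/quot_ind: a => x; rewrite !quotE mnegK. Qed.

HB.instance Definition _ := isPseudoMV.Build quotient
  quot_oplusA quot_oplusx0 quot_oplus0x quot_oplusx1 quot_oplus1x
  quot_mneg1 quot_tneg1 quot_mneg_tneg_oplus quot_joinC quot_joinE
  quot_joinE' quot_meetE quot_mnegK.

End Congruence.

Definition strongly_atomless (M : pseudoMVType) : Prop :=
  forall x : M, x <> 0 ->
    exists (P : set M) (nP : normal_ideal P),
      [/\ prime_ideal P, ~ P x & ~ atom (quot_class nP x)].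

(* Main.v *)
Require Import Defs.
From mathcomp Require Import all_boot.
From mathcomp Require Import boolp classical_sets.

(** Let [a = r 0] and [v = a^- \odot a^-].  If [v = 0] then [a^- <= a] by (Sq2),
    and [a <= a^-] always holds, so [r] is strict.  In general every [z <= v] is
    complemented by [z^-]: the element [w = z \meet z^-] squares to [0], so
    [w <= a], and an element below both [a] and [v] vanishes, because (Sq3)
    provides a half [t] of [w], [t \oplus t = w] and [a \oplus t = r w], and
    [w <= v] forces [r w \odot r w = 0].  Hence a normal prime ideal [P] contains
    [z] or [z^-], so that below [v/P] there are only [0] and [v/P]: if [v] is not
    in [P], then [v/P] is an atom, and strong atomlessness gives [v = 0]. *)

Local Open Scope classical_set_scope.
Local Open Scope pmv_scope.

Section Order.
Context {M : pseudoMVType}.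
Implicit Types x y z : M.

Lemma le0x x : pmv_le 0 x.
Proof. by apply/leE; rewrite odot0x. Qed.

Lemma le_odotl x y : pmv_le (x \odot y) x.
Proof. by apply/le_residr; exact: le_addr. Qed.

Lemma le_odotr x y : pmv_le (x \odot y) y.
Proof. by apply/le_residl; exact: le_addl. Qed.

Lemma le_odot2 x y x' y' :
  pmv_le x x' -> pmv_le y y' -> pmv_le (x \odot y) (x' \odot y').
Proof.
move=> hx hy; apply/le_residr; apply: le_trans hx _; apply/le_residr.
apply/le_residl; apply: le_trans hy _; apply/le_residl; exact: le_refl.
Qed.

Lemma le_meetl x y : pmv_le (x \meet y) x.
Proof. exact: le_odotl. Qed.

Lemma le_meetr x y : pmv_le (x \meet y) y.
Proof. by apply/le_residl; exact: le_refl. Qed.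

Lemma odot_eq0_mneg x y : x \odot y = 0 <-> pmv_le y x^[-].
Proof. by rewrite leE' mnegK. Qed.

Lemma odot_eq0_tneg x y : x \odot y = 0 <-> pmv_le x y^[~].
Proof. by rewrite leE tnegK. Qed.

(** By (A7) the left-hand product is [x \meet y^[-]]. *)
Lemma oplusK_meet {x y} : pmv_le x y^[-] -> (x \oplus y) \odot y^[-] = x.
Proof. by move=> h; rewrite -{2}h /pmv_meet meetE mnegK. Qed.

Lemma mneg2_odot x y :
  (x \odot y)^[-]^[-] = x^[-]^[-] \odot y^[-]^[-].
Proof. by rewrite mneg_odot mneg_oplus. Qed.

Lemma tneg2_odot x y :
  (x \odot y)^[~]^[~] = x^[~]^[~] \odot y^[~]^[~].
Proof. by rewrite tneg_odot tneg_oplus. Qed.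

End Order.

Section SquareRootTheory.
Context {M : pseudoMVType} {r : M -> M} (hr : square_root r).
Implicit Types x y z w : M.

Lemma sqrt_sq x : r x \odot r x = x.
Proof. by case: hr. Qed.

Lemma sqrt_max {x y} : pmv_le (y \odot y) x -> pmv_le y (r x).
Proof. by case: hr => _ + _; apply. Qed.

(* Double negation is an automorphism, and (Sq1)-(Sq2) determine [r]. *)
Lemma sqrt_mneg2 x : r x^[-]^[-] = (r x)^[-]^[-].
Proof.
apply: le_anti; last first.
  by apply: sqrt_max; rewrite -mneg2_odot sqrt_sq; exact: le_refl.
have h : pmv_le (r x^[-]^[-])^[~]^[~] (r x).
  by apply: sqrt_max; rewrite -tneg2_odot sqrt_sq !mnegK; exact: le_refl.
by move: (le_mneg (le_mneg h)); rewrite !tnegK.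
Qed.

(** Double negation fixes [0], hence [r 0]. *)
Lemma sqrt0_tneg : (r 0)^[~] = (r 0)^[-].
Proof. by have := sqrt_mneg2 0; rewrite mneg0 mneg1 => {1}->; rewrite mnegK. Qed.

Lemma le_sqrt0_mneg : pmv_le (r 0) (r 0)^[-].
Proof. by apply/odot_eq0_mneg; exact: sqrt_sq. Qed.

Lemma le_sqrt0 x : pmv_le (r 0) (r x).
Proof. by apply: sqrt_max; rewrite sqrt_sq; exact: le0x. Qed.

Lemma sqrt_half w : exists t,
  [/\ t \oplus t = w, r 0 \oplus t = r w & t \oplus r 0 = r w].
Proof.
case: hr => _ _ /(_ w)[]; rewrite /limpl /rimpl => hm ht.
(* By (Sq3) this is [(r 0)^[~] \odot r w], the left difference of [r w] and [r 0]; [e] identifies it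
   with the right difference [r w \odot (r 0)^[-]]. *)
exists (r w^[-])^[~].
have e : (r w^[-])^[~] = (r w^[~])^[-].
  by rewrite -{1}(tnegK w) sqrt_mneg2 mnegK.
split; first by rewrite -tneg_odot sqrt_sq mnegK.
  rewrite hm tneg_oplus mnegK; exact: esym (le_exr (le_sqrt0 w)).
rewrite e ht mneg_oplus tnegK; exact: esym (le_exl (le_sqrt0 w)).
Qed.

Lemma sqrt0_disjoint {w} :
  pmv_le w (r 0) -> pmv_le w ((r 0)^[-] \odot (r 0)^[-]) -> w = 0.
Proof.
move=> wa wv; have [t [tt at' ta]] := sqrt_half w.
have tw : pmv_le t w by rewrite -tt; exact: le_addr.
have bt : pmv_le (r 0)^[-] t^[~].
  by rewrite -sqrt0_tneg; exact: le_tneg (le_trans tw wa).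
have rt : pmv_le (r w) t^[-].
  apply/odot_eq0_mneg/odot_eq0_tneg.
  rewrite -at' tneg_oplus sqrt0_tneg; apply: le_trans (le_trans tw wv) _.
  exact: le_odot2 bt (le_refl _).
have h : pmv_le (r w \oplus t) (r 0)^[-].
  have -> : r w \oplus t = w \oplus r 0.
    by rewrite -ta -oplusA at' -ta oplusA tt.
  (* As [r 0] lies below [(r 0)^[-]], adding [r 0] to their difference [(r 0)^[-] \odot (r 0)^[-]]
     gives back [(r 0)^[-]]. *)
  apply: le_trans (le_oplus2r _ wv) _.
  by rewrite -(le_exl le_sqrt0_mneg); exact: le_refl.
rewrite -(sqrt_sq w); apply/odot_eq0_mneg.
(* Since [t] cancels by [rt], [r w = (r w \oplus t) \odot t^[-]], which [h] bounds by [(r 0)^[-]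
   \odot t^[-] = (r w)^[-]]. *)
rewrite -{1}(oplusK_meet rt) -ta mneg_oplus ta.
exact: le_odot2 h (le_refl _).
Qed.

Lemma le_sqrt0_complemented {z} :
  pmv_le z ((r 0)^[-] \odot (r 0)^[-]) -> z \meet z^[-] = 0.
Proof.
move=> zv; apply: sqrt0_disjoint; last exact: le_trans (le_meetl _ _) zv.
apply: sqrt_max; rewrite -(odot_mneg z).
by apply: le_odot2; [exact: le_meetl | exact: le_meetr].
Qed.

End SquareRootTheory.

Section Quotient.
Context {M : pseudoMVType} {P : set M} (nP : normal_ideal P).
Implicit Types x y : M.

Lemma ideal0 : P 0.
Proof. by have [[[i Pi] Ple _] _] := nP; apply: Ple Pi; exact: le0x. Qed.

Lemma quot_class_eq0 x : quot_class nP x = 0 <-> P x.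
Proof.
rewrite -[0]/(quot_class nP 0) quot_classP /ideal_cong mneg0 odotx1 odot0x.
by split=> [[]|Px] //; split=> //; exact: ideal0.
Qed.

Lemma quot_class_meet x y :
  quot_class nP x \meet quot_class nP y = quot_class nP (x \meet y).
Proof.
by rewrite /pmv_meet quot_class_mneg quot_class_oplus quot_class_odot.
Qed.

Lemma atom_complemented {v} : prime_ideal P ->
  (forall z, pmv_le z v -> z \meet z^[-] = 0) -> ~ P v ->
  atom (quot_class nP v).
Proof.
move=> [[_ Ple _] Pprime] hv nPv; split=> [/quot_class_eq0 //|Y].
(* A class below that of [v] has a representative below [v], namely [y \meet v]. *)
rewrite -(quot_classK Y); move: (repr Y) => y {Y}; rewrite {1}/pmv_le quot_class_meet => <-.
have zv := le_meetr y v; set z := y \meet v in zv *.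
move=> /quot_class_eq0 nPz; apply/quot_classP.
have [||Pz] := Pprime z z^[-] => //; first by rewrite hv //; exact: ideal0.
split; last exact: Ple (le_odotr _ _) Pz.
by move/leE: zv => ->; exact: ideal0.
Qed.

End Quotient.

Theorem theorem4p9 (M : pseudoMVType) (r : M -> M) (hr : square_root r)
  (hM : strongly_atomless M) : strict_square_root r.
Proof.
apply: le_anti; first exact: (le_sqrt0_mneg hr).
apply: (sqrt_max hr).
case: (pselect ((r 0)^[-] \odot (r 0)^[-] = 0)) => [->|/hM[P [nP [Pp nPv]]]].
  exact: le_refl.
by case; apply: atom_complemented => // z; exact: (le_sqrt0_complemented hr).
Qed.
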